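(* Let $\mathcal{M}=\{\mu_1,\dots,\mu_m\}$, $v_1,\dots,v_m$, $w_e$, the networks $M_{\mu^{(j)}}$, the coefficients $\theta^{(j)}_\ell(\mu)$, the approximations $\widehat{\mathrm N}^{(j)}$ and the errors $\mathcal{E}^{(j)}(v;\mu)$ be as produced by the NEIM training procedure described in the context. Then for each $\mu\in\mathcal{M}$ the function $$j\mapsto \sum_{i=1}^m w_e(\mu_i;\mu)\,\mathcal{E}^{(j-1)}(v_i;\mu)^2,\qquad j\in\mathbb{N}=\{1,2,\dots\},$$ is non-increasing (for $j$ ranging over the indices for which $\widehat{\mathrm N}^{(j-1)}$ is defined by the procedure). In particular, if $w_e(\mu_i;\mu)=\delta_{\mu_i\mu}$ (Kronecker delta), then for each $i\in\{1,\dots,m\}$ the function $j\mapsto \mathcal{E}^{(j-1)}(v_i;\mu_i)$, $j\in\mathbb{N}$, is non-increasing.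
   Context: Setting. Let $p,n,r\in\mathbb{N}$ with $r\le n$, let $\mathcal{P}\subset\mathbb{R}^p$ be a compact parameter space, and let $\mathrm N(\cdot;\mu):\mathbb{R}^n\to\mathbb{R}^n$, $\mu\in\mathcal{P}$, be a parameterized nonlinearity. Let $v(\mu)\in\mathbb{R}^n$ denote the high-fidelity solution of a discretized parameterized PDE $A(\mu)v+\mathrm N(v;\mu)=f(\mu)$, where $A(\mu)\in\mathbb{R}^{n\times n}$, $f(\mu)\in\mathbb{R}^n$. Let $U\in\mathbb{R}^{n\times r}$ be the matrix of the first $r$ left singular vectors (POD basis) of a snapshot matrix of solutions; its columns are orthonormal. Let $\mathcal{M}=\{\mu_1,\dots,\mu_m\}\subset\mathcal{P}$ be a finite set of (distinct) parameters, $v_i=v(\mu_i)\in\mathbb{R}^n$ and $\tilde v_i=U^\top v_i\in\mathbb{R}^r$. The numbers $w_e(\mu_i;\mu)\in[0,\infty)$ (''error weights'', $\mu_i,\mu\in\mathcal{M}$) and $w_t^{(j)}(\mu_i)\in[0,\infty)$ (''training weights'') are given. $\|\cdot\|_2$ and $\langle\cdot,\cdot\rangle$ are the Euclidean norm and inner product. NEIM (neural empirical interpolation method) training procedure. Set $\widehat{\mathrm N}^{(0)}\equiv 0$. For every iterate define, for $\mu\in\mathcal{M}$ and $v\in\mathbb{R}^n$, $$\mathcal{E}^{(j)}(v;\mu)=\|U^\top \mathrm N(v;\mu)-\widehat{\mathrm N}^{(j)}(U^\top v;\mu)\|_2 .$$ At iteration $j=1,2,\dots$ (until a stopping criterion is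 met): 1. Choose $\mu^{(j)}\in\arg\max_{\mu\in\mathcal{M}\setminus\{\mu^{(1)},\dots,\mu^{(j-1)}\}}\sum_{i=1}^m w_e(\mu_i;\mu)\,\mathcal{E}^{(j-1)}(v_i;\mu)^2$. 2. For $i=1,\dots,m$ let $y^{(j)}(\mu_i)=U^\top \mathrm N(v_i;\mu^{(j)})$, and let $z^{(j)}(\mu_i)$ be obtained from it by Gram–Schmidt: start with $z=y^{(j)}(\mu_i)$; for $k=1,\dots,j-1$ replace $z$ by $z-\frac{\langle z,M_{\mu^{(k)}}(\tilde v_i)\rangle}{\|M_{\mu^{(k)}}(\tilde v_i)\|_2^2}M_{\mu^{(k)}}(\tilde v_i)$; finally put $z^{(j)}(\mu_i)=z/\|z\|_2$. 3. Obtain a feedforward neural network $M_{\mu^{(j)}}:\mathbb{R}^r\to\mathbb{R}^r$ by training, i.e. by (numerically) minimizing $\sum_{i=1}^m w_t^{(j)}(\mu_i)\|M_{\mu^{(j)}}(\tilde v_i)-z^{(j)}(\mu_i)\|_2^2$ over the network parameters. (The training need not be exact; its result is some function $\mathbb{R}^r\to\mathbb{R}^r$.) 4. For each $\mu\in\mathcal{M}$ choose $\theta_1^{(j)}(\mu),\dots,\theta_j^{(j)}(\mu)\in\mathbb{R}$ (all recomputed at iteration $j$) minimizing over $\theta\in\mathbb{R}^j$ the quantity $$\sum_{i=1}^m w_e(\mu_i;\mu)\Big\|U^\top \mathrm N(v_i;\mu)-\sum_{\ell=1}^j\theta_\ell\, M_{\mu^{(\ell)}}(\tilde v_i)\Big\|_2^2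 .$$ 5. Set $\widehat{\mathrm N}^{(j)}(\tilde v;\mu)=\sum_{\ell=1}^j\theta_\ell^{(j)}(\mu)M_{\mu^{(\ell)}}(\tilde v)$ for $\tilde v\in\mathbb{R}^r$, $\mu\in\mathcal{M}$. *)

(* Defs.v *)
(* MathComp / MathComp-Analysis; vectors of R^k are column vectors 'cV[R]_k. *)
From HB Require Import structures.
From mathcomp Require Export all_boot all_order all_algebra.
From mathcomp Require Export all_classical all_reals all_analysis.

Set Implicit Arguments.
Unset Strict Implicit.
Unset Printing Implicit Defensive.

Import Order.TTheory GRing.Theory Num.Theory.
Local Open Scope classical_set_scope.
Local Open Scope ring_scope.

Section Euclidean.
Context {R : realType}.

Definition dotv k (x y : 'cV[R]_k) : R := \sum_(i < k) x i 0 * y i 0.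

(* The norm `|x| that the library puts on matrices is the max norm. *)
Definition norm2 k (x : 'cV[R]_k) : R := Num.sqrt (dotv x x).

(* Sequential Gram-Schmidt sweep of y against b 1, ..., b k, in this order and
   without normalization; division being total, a zero b l is skipped. *)
Definition gram_schmidt_sweep d (b : nat -> 'cV[R]_d) (k : nat)
    (y : 'cV[R]_d) : 'cV[R]_d :=
  foldl (fun z l => z - (dotv z (b l) / norm2 (b l) ^+ 2) *: b l) y (iota 1 k).

(* S = W Sigma V^T is a full singular value decomposition, where sigma lists
   the singular values; entries beyond min(n, s) play no role. *)
Definition is_svd n s (S : 'M[R]_(n, s))
    (W : 'M[R]_n) (sigma : nat -> R) (V : 'M[R]_s) : Prop :=
  [/\ W^T *m W = 1%:M,
      V^T *m V = 1%:M,
      forall k, 0 <= sigma k,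
      forall k l, (k <= l)%N -> sigma l <= sigma k &
      S = W *m (\matrix_(i < n, j < s) (sigma i *+ (i == j :> nat))) *m V^T].

(* Singular vectors are not unique, hence a relation. *)
Definition is_POD_basis n s r (le_rn : (r <= n)%N) (S : 'M[R]_(n, s))
    (U : 'M[R]_(n, r)) : Prop :=
  exists W sigma V, is_svd S W sigma V /\ U = colsub (widen_ord le_rn) W.

Definition snapshot_mx p n s (v : 'cV[R]_p -> 'cV[R]_n)
    (nu : 'I_s -> 'cV[R]_p) : 'M[R]_(n, s) :=
  \matrix_(i < n, k < s) v (nu k) i 0.

End Euclidean.

Section NEIM.
Context {R : realType} {p n r m : nat}.
Variable N : 'cV[R]_n -> 'cV[R]_p -> 'cV[R]_n.
Variable v : 'cV[R]_p -> 'cV[R]_n.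
Variable U : 'M[R]_(n, r).
Variable mus : 'I_m -> 'cV[R]_p.
Variable we : 'cV[R]_p -> 'cV[R]_p -> R.

(* The error of the approximation Nh at a full-order state x. *)
Definition neim_err (Nh : 'cV[R]_r -> 'cV[R]_p -> 'cV[R]_r)
    (x : 'cV[R]_n) (mu : 'cV[R]_p) : R :=
  norm2 (U^T *m N x mu - Nh (U^T *m x) mu).

Definition neim_weighted_err (Nh : 'cV[R]_r -> 'cV[R]_p -> 'cV[R]_r)
    (mu : 'cV[R]_p) : R :=
  \sum_(i < m) we (mus i) mu * neim_err Nh (v (mus i)) mu ^+ 2.

Variable wt : nat -> 'cV[R]_p -> R.
(* sel j is the parameter selected at iteration j >= 1, and net mu the network
   attached to a selected parameter mu. *)
Variable sel : nat -> 'cV[R]_p.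
Variable net : 'cV[R]_p -> 'cV[R]_r -> 'cV[R]_r.

Definition neim_target (j : nat) (i : 'I_m) : 'cV[R]_r :=
  let z := gram_schmidt_sweep (fun k => net (sel k) (U^T *m v (mus i))) j.-1
             (U^T *m N (v (mus i)) (sel j)) in
  (norm2 z)^-1 *: z.

Definition neim_loss (j : nat) (M : 'cV[R]_r -> 'cV[R]_r) : R :=
  \sum_(i < m) wt j (mus i) *
    norm2 (M (U^T *m v (mus i)) - neim_target j i) ^+ 2.

(* Networks are numbered from 1, coordinates of c from 0. *)
Definition neim_comb (j : nat) (c : 'rV[R]_j) (x : 'cV[R]_r) : 'cV[R]_r :=
  \sum_(l < j) c 0 l *: net (sel l.+1) x.

Definition neim_lsq (j : nat) (mu : 'cV[R]_p) (c : 'rV[R]_j) : R :=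
  \sum_(i < m) we (mus i) mu *
    norm2 (U^T *m N (v (mus i)) mu - neim_comb c (U^T *m v (mus i))) ^+ 2.

(* At iteration j the networks under consideration are the functions arch j w,
   for w : W j the network parameters (weights and biases).  Training is an
   arbitrary procedure train j sending a loss function on W j to network
   parameters: it is not assumed to reach, or even to approach, a minimum. *)
Variable W : nat -> Type.
Variable arch : forall j, W j -> 'cV[R]_r -> 'cV[R]_r.
Variable train : forall j, (W j -> R) -> W j.
Variable theta : forall j, 'cV[R]_p -> 'rV[R]_j.
Variable Nhat : nat -> 'cV[R]_r -> 'cV[R]_p -> 'cV[R]_r.

(* J iterations have been carried out; sel j, theta j for j outside 1..J, and
   Nhat j for j > J, are meaningless.  The selected parameters being distinct
   elements of range mus, this forces J <= m. *)
Record neim_training (J : nat) : Prop := NeimTraining {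
  neim_init : forall x mu, range mus mu -> Nhat 0 x mu = 0;
  neim_select_mem : forall j, (1 <= j <= J)%N ->
    range mus (sel j) /\ (forall k, (1 <= k < j)%N -> sel j <> sel k);
  neim_select_max : forall j, (1 <= j <= J)%N ->
    forall mu, range mus mu -> (forall k, (1 <= k < j)%N -> mu <> sel k) ->
    neim_weighted_err (Nhat j.-1) mu <= neim_weighted_err (Nhat j.-1) (sel j);
  neim_train : forall j, (1 <= j <= J)%N ->
    net (sel j) = arch (train (fun w : W j => neim_loss j (arch w)));
  neim_theta_min : forall j, (1 <= j <= J)%N ->
    forall mu, range mus mu ->
    forall c : 'rV[R]_j, neim_lsq mu (theta j mu) <= neim_lsq mu c;
  neim_update : forall j, (1 <= j <= J)%N ->
    forall x mu, range mus mu -> Nhat j x mu = neim_comb (theta j mu) x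
}.

End NEIM.

(* Main.v *)
(* Padding the coefficients of iteration j with a zero gives an admissible
   competitor in the least-squares problem of iteration j + 1 with the same
   objective value, so the minimum can only decrease. *)
Require Import Defs.

Set Implicit Arguments.
Unset Strict Implicit.
Unset Printing Implicit Defensive.

Import Order.TTheory GRing.Theory Num.Theory numFieldNormedType.Exports.
Local Open Scope classical_set_scope.
Local Open Scope ring_scope.

(** The networks of iteration [j] are reused unchanged at [j.+1], so the padded coefficient only
    multiplies the newest network, the one of [sel j.+1]. *)
Lemma neim_comb_pad (R : realType) (p r : nat) (sel : nat -> 'cV[R]_p)
  (net : 'cV[R]_p -> 'cV[R]_r -> 'cV[R]_r) (j : nat) (c : 'rV[R]_j)
  (x : 'cV[R]_r) :
  neim_comb sel net (\row_(l < j.+1) oapp (c 0) 0 (unlift ord_max l)) x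
    = neim_comb sel net c x.
Proof.
(* At [ord_max], [unlift] returns [None], so [oapp] yields its default value 0. *)
rewrite /neim_comb big_ord_recr /= mxE unlift_none /= scale0r addr0.
apply: eq_bigr => l _; rewrite mxE.
(* Splitting the sum produces [widen_ord], whereas [unlift] inverts [lift]; lifting past the last
   index shifts nothing, so the two embeddings agree. *)
have -> : widen_ord (leqnSn j) l = lift ord_max l.
  by apply: val_inj; rewrite [RHS]lift_max.
by rewrite liftK.
Qed.

Section Training.
Context {R : realType} {p n r m : nat}.
Variables (N : 'cV[R]_n -> 'cV[R]_p -> 'cV[R]_n) (v : 'cV[R]_p -> 'cV[R]_n).
Variables (U : 'M[R]_(n, r)) (mus : 'I_m -> 'cV[R]_p).
Variables (we : 'cV[R]_p -> 'cV[R]_p -> R) (wt : nat -> 'cV[R]_p -> R).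
Variables (sel : nat -> 'cV[R]_p) (net : 'cV[R]_p -> 'cV[R]_r -> 'cV[R]_r).
Variables (W : nat -> Type) (arch : forall j, W j -> 'cV[R]_r -> 'cV[R]_r).
Variable train : forall j, (W j -> R) -> W j.
Variable theta : forall j, 'cV[R]_p -> 'rV[R]_j.
Variable Nhat : nat -> 'cV[R]_r -> 'cV[R]_p -> 'cV[R]_r.
Variable J : nat.
Hypothesis run : neim_training N v U mus we wt sel net arch train theta Nhat J.

(** The zero initialization is the empty combination, so iterate 0 needs no separate treatment
    afterwards. *)
Lemma neim_Nhat_comb j x mu : (j <= J)%N -> range mus mu ->
  Nhat j x mu = neim_comb sel net (theta j mu) x.
Proof.
case: j => [|j] leJ mu_in; last exact: (neim_update run).
by rewrite (neim_init run) // /neim_comb big_ord0.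
Qed.

Lemma neim_weighted_errE j mu : (j <= J)%N -> range mus mu ->
  neim_weighted_err N v U mus we (Nhat j) mu
    = neim_lsq N v U mus we sel net mu (theta j mu).
Proof.
move=> leJ mu_in; apply: eq_bigr => i _.
by rewrite /neim_err neim_Nhat_comb.
Qed.

Lemma neim_weighted_errS j mu : (j < J)%N -> range mus mu ->
  neim_weighted_err N v U mus we (Nhat j.+1) mu
    <= neim_weighted_err N v U mus we (Nhat j) mu.
Proof.
move=> ltJ mu_in; rewrite !neim_weighted_errE ?(ltnW ltJ) //.
pose c := \row_(l < j.+1) oapp (theta j mu 0) 0 (unlift ord_max l).
(* Only the optimality of [theta j.+1 mu] is invoked, so the step from iterate 0 to iterate 1 is
   covered as well. *)
suff -> : neim_lsq N v U mus we sel net mu (theta j mu)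
    = neim_lsq N v U mus we sel net mu c by exact: (neim_theta_min run).
by apply: eq_bigr => i _; rewrite neim_comb_pad.
Qed.

Lemma neim_weighted_err_nonincreasing j k mu :
  (j <= k)%N -> (k <= J)%N -> range mus mu ->
  neim_weighted_err N v U mus we (Nhat k) mu
    <= neim_weighted_err N v U mus we (Nhat j) mu.
Proof.
(* The bound [k <= J] stays in the goal, so that it becomes a premise of the induction
   hypothesis. *)
move=> lejk + mu_in; elim: k lejk => [|k IHk].
  by rewrite leqn0 => /eqP ->.
rewrite leq_eqVlt => /predU1P[-> //|]; rewrite ltnS => lejk ltkJ.
exact: le_trans (neim_weighted_errS ltkJ mu_in) (IHk lejk (ltnW ltkJ)).
Qed.

End Training.

(** Since the parameters are distinct, a Kronecker delta on parameters is one on indices, and a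
    single term of the sum survives. *)
Lemma neim_weighted_err_kronecker (R : realType) (p n r m : nat)
  (N : 'cV[R]_n -> 'cV[R]_p -> 'cV[R]_n) (v : 'cV[R]_p -> 'cV[R]_n)
  (U : 'M[R]_(n, r)) (mus : 'I_m -> 'cV[R]_p)
  (we : 'cV[R]_p -> 'cV[R]_p -> R)
  (Nh : 'cV[R]_r -> 'cV[R]_p -> 'cV[R]_r) (i : 'I_m) :
  injective mus ->
  (forall k, we (mus k) (mus i) = (mus k == mus i)%:R) ->
  neim_weighted_err N v U mus we Nh (mus i)
    = neim_err N U Nh (v (mus i)) (mus i) ^+ 2.
Proof.
move=> mus_inj weE; rewrite /neim_weighted_err (bigD1 i) //= weE eqxx mul1r.
rewrite big1 ?addr0 // => k neq_ki.
by rewrite weE (inj_eq mus_inj) (negbTE neq_ki) mul0r.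
Qed.

Theorem proposition1 (R : realType) (p n r : nat)
  (p_gt0 : (0 < p)%N) (n_gt0 : (0 < n)%N) (r_gt0 : (0 < r)%N)
  (le_rn : (r <= n)%N)
  (P : set 'cV[R]_p) (P_compact : compact P)
  (N : 'cV[R]_n -> 'cV[R]_p -> 'cV[R]_n)
  (A : 'cV[R]_p -> 'M[R]_n) (f v : 'cV[R]_p -> 'cV[R]_n)
  (v_sol : forall mu, P mu -> A mu *m v mu + N (v mu) mu = f mu)
  (s : nat) (nu : 'I_s -> 'cV[R]_p) (nu_P : forall k, P (nu k))
  (U : 'M[R]_(n, r)) (U_POD : is_POD_basis le_rn (snapshot_mx v nu) U)
  (m : nat) (mus : 'I_m -> 'cV[R]_p) (mus_inj : injective mus)
  (mus_P : forall i, P (mus i))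
  (we : 'cV[R]_p -> 'cV[R]_p -> R)
  (we_ge0 : forall mu mu', range mus mu -> range mus mu' -> 0 <= we mu mu')
  (wt : nat -> 'cV[R]_p -> R)
  (wt_ge0 : forall j mu, range mus mu -> 0 <= wt j mu)
  (sel : nat -> 'cV[R]_p)
  (net : 'cV[R]_p -> 'cV[R]_r -> 'cV[R]_r)
  (W : nat -> Type) (arch : forall j, W j -> 'cV[R]_r -> 'cV[R]_r)
  (train : forall j, (W j -> R) -> W j)
  (theta : forall j, 'cV[R]_p -> 'rV[R]_j)
  (Nhat : nat -> 'cV[R]_r -> 'cV[R]_p -> 'cV[R]_r)
  (J : nat)
  (run : neim_training N v U mus we wt sel net arch train theta Nhat J) :
  (forall mu, range mus mu ->
     forall j k, (1 <= j)%N -> (j <= k)%N -> (k <= J.+1)%N ->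
     neim_weighted_err N v U mus we (Nhat k.-1) mu
       <= neim_weighted_err N v U mus we (Nhat j.-1) mu)
  /\
  ((forall i mu, range mus mu -> we (mus i) mu = (mus i == mu)%:R) ->
   forall i j k, (1 <= j)%N -> (j <= k)%N -> (k <= J.+1)%N ->
     neim_err N U (Nhat k.-1) (v (mus i)) (mus i)
       <= neim_err N U (Nhat j.-1) (v (mus i)) (mus i)).
Proof.
have mono mu : range mus mu -> forall j k,
    (1 <= j)%N -> (j <= k)%N -> (k <= J.+1)%N ->
    neim_weighted_err N v U mus we (Nhat k.-1) mu
      <= neim_weighted_err N v U mus we (Nhat j.-1) mu.
  (* Passing from the index [j >= 1] to the iterate [j.-1] turns the bound [J.+1] into [J]. *)
  move=> mu_in [//|j] [//|k] _; rewrite !ltnS /= => lejk lekJ.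
  exact: (neim_weighted_err_nonincreasing run).
split=> // weE i j k j_gt0 lejk lekJ.
have mu_in : range mus (mus i) by exists i.
(* Errors are square roots, hence nonnegative, so it suffices to compare their squares, which are
   weighted errors for delta weights. *)
rewrite -(@ler_pXn2r _ 2) ?nnegrE ?sqrtr_ge0 //.
have we_i l : we (mus l) (mus i) = (mus l == mus i)%:R by exact: weE.
rewrite -!(neim_weighted_err_kronecker N v U _ mus_inj we_i).
exact: mono.
Qed.
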